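(* Let $f:\mathbb{R}^m\to\mathbb{R}$ be a convex $C^1$-function which has a minimizer $x^*\in\mathbb{R}^m$, i.e. $f(x^* )=\inf_{x\in\mathbb{R}^m} f(x)$, and let $x:[0,\infty)\to\mathbb{R}^m$, $t\mapsto x_t$, be a gradient flow of $f$. Then \[ \int_0^\infty \big(f(x_t)-\inf f\big)\,\mathrm{d}t\le \frac{\|x_0-x^*\|^2}{2}. \]
   Context: A gradient flow of a $C^1$-function $f$ is a differentiable curve $x:[0,\infty)\to\mathbb{R}^m$ satisfying $\dot x_t=-\nabla f(x_t)$ for all $t\ge 0$. $\|\cdot\|$ is the Euclidean norm. *)

(* Defs.v *)
From mathcomp Require Import all_boot all_order all_algebra.
From mathcomp Require Import all_classical all_reals all_analysis.

Set Implicit Arguments.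
Unset Strict Implicit.
Unset Printing Implicit Defensive.

Import Order.TTheory GRing.Theory Num.Theory.
Import numFieldNormedType.Exports.

Local Open Scope classical_set_scope.
Local Open Scope ring_scope.

(* The library norm `|v| on 'rV[R]_m is the sup norm: it defines the same
   topology and the same derivatives, but it is not the norm wanted here. *)
Definition enorm (R : realType) (m : nat) (v : 'rV[R]_m) : R :=
  Num.sqrt (\sum_(i < m) v ord0 i ^+ 2).

Definition grad (R : realType) (m : nat) (f : 'rV[R]_m -> R)
    (p : 'rV[R]_m) : 'rV[R]_m :=
  \row_(i < m) 'D_(delta_mx ord0 i) f p.

Definition C1 (R : realType) (m : nat) (f : 'rV[R]_m -> R) : Prop :=
  (forall p, differentiable f p) /\ continuous (grad f).

(* inf f is taken in \bar R, because the real-valued inf is 0 by convention on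
   a set that is not bounded below. *)
Definition inff (R : realType) (m : nat) (f : 'rV[R]_m -> R) : \bar R :=
  ereal_inf (range (fun y => (f y)%:E)).

Definition minimizer (R : realType) (m : nat) (f : 'rV[R]_m -> R)
    (p : 'rV[R]_m) : Prop :=
  (f p)%:E = inff f.

(* A curve on [0, +oo[ is a total function whose values at negative times are
   irrelevant: difference quotients only use times s >= 0, so the derivative
   at t = 0 is one-sided. *)
Definition gradient_flow (R : realType) (m : nat) (f : 'rV[R]_m -> R)
    (x : R -> 'rV[R]_m) : Prop :=
  forall t : R, 0 <= t ->
    (s - t)^-1 *: (x s - x t) @[s --> within `[0, +oo[ t^'] --> - grad f (x t).

(* Main.v *)
(** By convexity f (x_t) - f x* <= <grad f (x_t), x_t - x*>, and the right-hand
    side is the derivative of F t = - |x_t - x*|^2 / 2. So F is nondecreasing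
    and bounded above by 0: it has a limit l <= 0, and the fundamental theorem
    of calculus on [0, +oo[ bounds the integral by l - F 0 <= |x_0 - x*|^2 / 2. *)

Require Import Defs.
From mathcomp Require Import all_boot all_order all_algebra.
From mathcomp Require Import all_classical all_reals all_analysis.
From mathcomp Require Import measurable_realfun ring.

Set Implicit Arguments.
Unset Strict Implicit.
Unset Printing Implicit Defensive.

Import Order.TTheory GRing.Theory Num.Theory.
Import numFieldNormedType.Exports.

Local Open Scope classical_set_scope.
Local Open Scope ring_scope.

(** The differential is linear, so it suffices to expand [v] in the standard basis. *)
Lemma derive_grad (R : realType) (m : nat) (f : 'rV[R]_m -> R) (p v : 'rV[R]_m) :
  differentiable f p -> 'D_v f p = \sum_(i < m) v ord0 i * grad f p ord0 i.
Proof.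
move=> fp; rewrite deriveE// {1}(row_sum_delta v) linear_sum.
by apply: eq_bigr => i _; rewrite linearZ mxE deriveE.
Qed.

(** Convexity bounds the difference quotient of step [h] by [f q - f p] only for 0 < h <= 1, hence
    the passage to the right-hand limit. *)
Lemma convex_le_derive (R : realType) (m : nat) (f : 'rV[R]_m -> R)
    (p q : 'rV[R]_m) :
  convex_function setT f -> derivable f p (q - p) ->
  'D_(q - p) f p <= f q - f p.
Proof.
move=> f_convex /cvg_dnbhs_at_right fp.
apply: (cvgr_to_le fp).
near=> h.
have h0 : 0 < h by near: h; exact: nbhs_right_gt.
have h1 : h <= 1 by near: h; exact: nbhs_right_le.
(* The weight [h] goes to [q], so that the convex combination is p + h (q - p). *)
have := f_convex (Itv01 (ltW h0) h1) q p.
rewrite !inE => /(_ I I); rewrite convRE /= /unstable.onem => fh.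
have -> : h *: (q - p) + p = h *: q + (1 - h) *: p.
  by rewrite scalerBr scalerBl scale1r addrAC addrA.
rewrite /GRing.scale/= mulrC ler_pdivrMr// lerBlDr (le_trans fh)//.
by rewrite le_eqVlt; apply/orP; left; apply/eqP; rewrite /unstable.onem; ring.
Unshelve. all: by end_near. Qed.

Lemma flow_within_continuous (R : realType) (m : nat) (f : 'rV[R]_m -> R)
    (x : R -> 'rV[R]_m) :
  gradient_flow f x -> {within `[0, +oo[, continuous x}.
Proof.
move=> x_flow; apply/subspace_continuousP => /= t; rewrite /= in_itv/= andbT => t0.
have xt : x s @[s --> within `[0, +oo[ t^'] --> x t.
  have sub0 : s - t @[s --> within `[0, +oo[ t^'] --> 0.
    have st : s @[s --> within `[0, +oo[ t^'] --> t.
      apply: (cvg_trans _ (@nbhs_dnbhs _ t)) => U Ut.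
      by rewrite /nbhs/= /within; apply: filterS Ut => s Us _.
    by rewrite -[X in _ --> X](subrr t); exact: (cvgB st (cvg_cst t)).
  (* A vanishing factor times a convergent quotient; at s = t the identity survives because the
     outer factor is 0. *)
  have xE s : x s = (s - t) *: ((s - t)^-1 *: (x s - x t)) + x t.
    have [->|st] := eqVneq s t; first by rewrite subrr scale0r add0r.
    by rewrite scalerA divff ?subr_eq0// scale1r subrK.
  rewrite (eq_cvg _ _ xE).
  suff : (s - t) *: ((s - t)^-1 *: (x s - x t)) + x t
      @[s --> within `[0, +oo[ t^'] --> 0 *: (- grad f (x t)) + x t.
    by rewrite scale0r add0r.
  exact: cvgD (cvgZ sub0 (x_flow t t0)) (cvg_cst (x t)).
(* The limit so far is over punctured neighbourhoods; the point [t] itself is added back. *)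
move=> U Ut.
have {}xt : \forall s \near t, s != t -> `[0, +oo[%classic s -> U (x s) :=
  xt U Ut.
suff : \forall s \near t, `[0, +oo[%classic s -> U (x s) by [].
apply: filterS xt => s Us s0.
by have [->|/Us] := eqVneq s t; [exact: nbhs_singleton|exact].
Qed.

(** Near t > 0 the constraint s >= 0 is void, so the flow equation gives a two-sided derivative,
    read off coordinatewise. *)
Lemma flow_is_derive (R : realType) (m : nat) (f : 'rV[R]_m -> R)
    (x : R -> 'rV[R]_m) (t : R) (i : 'I_m) :
  gradient_flow f x -> 0 < t ->
  is_derive t 1 (fun s => x s ord0 i) (- grad f (x t) ord0 i).
Proof.
move=> x_flow t0.
have xt : (s - t)^-1 *: (x s - x t) @[s --> t^'] --> - grad f (x t).
  apply: cvg_trans (x_flow t (ltW t0)).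
  apply: cvg_app => U Ut.
  have tpos : \forall s \near t^', 0 < s by apply/nbhs_dnbhs/lt_nbhsr.
  have {}Ut : \forall s \near t^', `[0, +oo[%classic s -> U s := Ut.
  near=> s; apply: (near Ut s _) => //.
  by rewrite /= in_itv/= andbT ltW//; near: s.
have xti : (s - t)^-1 * (x s ord0 i - x t ord0 i) @[s --> t^'] -->
    - grad f (x t) ord0 i.
  have -> : (- grad f (x t) ord0 i) = (- grad f (x t)) ord0 i.
    by rewrite [RHS]mxE.
  have := cvg_comp _ _ xt (@coord_continuous _ _ _ ord0 i (- grad f (x t))).
  apply: cvg_trans.
  by apply: near_eq_cvg; near=> s; rewrite /= !mxE.
(* Substituting s = h + t gives the quotient in the form that defines the derivative. *)
have quot_cvg :
    (fun h => h^-1 *: (((fun s => x s ord0 i) \o shift t) (h *: 1)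
      - x t ord0 i)) @ 0^' --> - grad f (x t) ord0 i.
  move=> U /xti.
  rewrite /nbhs/= /dnbhs /within/= !near_simpl (near_shift 0) subr0.
  apply: filterS => h /= Uh h0.
  by rewrite scaler1; have := Uh; rewrite addrK; apply; rewrite -subr_eq0 addrK.
apply: DeriveDef; first by apply/cvg_ex; eexists; exact: quot_cvg.
exact: cvg_lim.
Unshelve. all: by end_near. Qed.

(** A polynomial in the coordinates, free of the square root of [enorm], hence directly
    differentiable. *)
Definition sqdist (R : realType) (m : nat) (a b : 'rV[R]_m) : R :=
  \sum_(i < m) (a ord0 i - b ord0 i) ^+ 2.

Lemma sum_continuous (R : realType) (T : topologicalType) (m : nat)
    (g : 'I_m -> T -> R) :
  (forall i, continuous (g i)) -> continuous (fun p => \sum_(i < m) g i p).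
Proof.
move=> cg; apply: continuous_big => [|i _]; first exact: add_continuous.
exact: cg.
Qed.

Lemma subr_coord_continuous (R : realType) (m : nat) (b : 'rV[R]_m) (i : 'I_m) :
  continuous (fun p : 'rV[R]_m => p ord0 i - b ord0 i).
Proof.
move=> p; apply: (@continuousB R R^o 'rV[R]_m (fun q => q ord0 i) (cst _)).
  exact: coord_continuous.
exact: cst_continuous.
Qed.

(** Chain rule in each coordinate: the minus sign of the flow cancels the leading one, and the 2
    from the square cancels the division by 2. *)
Lemma flow_sqdist_is_derive (R : realType) (m : nat) (f : 'rV[R]_m -> R)
    (x : R -> 'rV[R]_m) (b : 'rV[R]_m) (t : R) :
  gradient_flow f x -> 0 < t ->
  is_derive t 1 (fun s => - (sqdist (x s) b / 2))
    (\sum_(i < m) (x t ord0 i - b ord0 i) * grad f (x t) ord0 i).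
Proof.
move=> x_flow t0.
have dx i : is_derive t 1 (fun s => x s ord0 i) (- grad f (x t) ord0 i).
  exact: flow_is_derive.
(* In the algebra of functions, the derivative can be inferred from [dx]. *)
have -> : (fun s => - (sqdist (x s) b / 2)) =
    (- 2^-1) \*: (\sum_(i < m) ((fun s => x s ord0 i) - cst (b ord0 i)) ^+ 2).
  apply/funext => s; rewrite /= /GRing.scale/= fct_sumE mulNr mulrC.
  by congr (- (_ * _)); apply: eq_bigr => i _; rewrite fctE.
apply: is_derive_eq.
rewrite scaler_sumr; apply: eq_bigr => i _.
by rewrite /GRing.scale/= !fctE subr0 expr1; field.
Qed.

Theorem lemma2p3 (R : realType) (m : nat) (f : 'rV[R]_m -> R)
    (xstar : 'rV[R]_m) (x : R -> 'rV[R]_m)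
    (f_convex : convex_function setT f)
    (f_C1 : C1 f)
    (xstar_min : minimizer f xstar)
    (x_flow : gradient_flow f x) :
  (\int[lebesgue_measure]_(t in `[0%R, +oo[) ((f (x t))%:E - inff f)
     <= (enorm (x 0%R - xstar) ^+ 2 / 2)%:E)%E.
Proof.
have [df cgrad] := f_C1.
pose gap (p : 'rV[R]_m) := f p - f xstar.
pose h (p : 'rV[R]_m) :=
  \sum_(i < m) (p ord0 i - xstar ord0 i) * grad f p ord0 i.
pose F s := - (sqdist (x s) xstar / 2).
have cx := flow_within_continuous x_flow.
have gap_ge0 p : 0 <= gap p.
  rewrite subr_ge0 -lee_fin xstar_min; apply: ereal_inf_lbound.
  by exists p.
(* First-order convexity inequality at [p] in the direction [xstar - p], with both sides negated. *)
have gap_le p : gap p <= h p.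
  have := convex_le_derive f_convex
    (@diff_derivable _ _ _ _ _ (xstar - p) (df p)).
  rewrite derive_grad// => le_gap.
  rewrite /gap -[f p - _]opprB lerNl (le_trans _ le_gap)//.
  rewrite -sumrN; apply: ler_sum => i _.
  by rewrite !mxE -mulNr opprB.
(* Continuity is relative to the half-line, since [x] is arbitrary at negative times. *)
have c_comp (g : 'rV[R]_m -> R) : continuous g ->
    {within `[0, +oo[, continuous (g \o x)}.
  move=> cg t.
  apply: (@continuous_comp (subspace `[0 : R, +oo[) 'rV[R]_m R x g t).
    exact: cx.
  exact: cg.
have cgap : continuous gap.
  move=> p; apply: (@continuousB R R^o 'rV[R]_m f (cst _)).
    exact: differentiable_continuous.
  exact: cst_continuous.
have ch : continuous h.
  apply: sum_continuous => i p.
  apply: (@continuousM R 'rV[R]_m (fun q => q ord0 i - xstar ord0 i)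
    (fun q => grad f q ord0 i)); first exact: subr_coord_continuous.
  exact: (cvg_comp _ _ (cgrad p) (@coord_continuous _ _ _ ord0 i _)).
have cF : {within `[0, +oo[, continuous F}.
  apply: (c_comp (fun p => - (sqdist p xstar / 2))) => p.
  apply: (@continuousN R R^o 'rV[R]_m).
  apply: (@continuousM R 'rV[R]_m (fun p => sqdist p xstar) (cst _));
    last exact: cst_continuous.
  apply: sum_continuous => i q.
  by apply: (@continuousM R 'rV[R]_m); exact: subr_coord_continuous.
have F_le0 s : F s <= 0.
  rewrite oppr_le0 divr_ge0// sumr_ge0// => i _; exact: sqr_ge0.
have dF (s : R) : 0 < s -> is_derive s 1 F (h (x s)).
  exact: flow_sqdist_is_derive.
have F_ndecr s t : 0 <= s -> s <= t -> F s <= F t.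
  move=> s0 st.
  (* The derivative is known only at positive times; continuity [cF] covers the endpoint 0. Its sign
     comes from 0 <= gap <= h. *)
  apply: (@ger0_derive1_ndecry _ _ 0) => // r; rewrite in_itv/= andbT => /dF dFr.
    exact: ex_derive.
  by rewrite derive1E derive_val (le_trans _ (gap_le _)).
have [l [Fl l_le0]] : exists l, F s @[s --> +oo] --> l /\ l <= 0.
  (* F is monotone only on [0, +oo[, so its negative times are frozen at F 0. *)
  pose G s := F (Num.max 0 s).
  have G_ndecr : nondecreasing_fun G.
    move=> s t st; apply: F_ndecr; first by rewrite le_max lexx.
    by rewrite ge_max !le_max lexx st orbT.
  have Gub : has_ubound (range G) by exists 0 => _ [s _ <-]; exact: F_le0.
  exists (sup (range G)); split.
    apply: cvg_trans (nondecreasing_cvgr G_ndecr Gub).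
    apply: near_eq_cvg; near=> s; rewrite /G max_r//.
  by apply: ge_sup; [exists (G 0), 0|move=> _ [s _ <-]; exact: F_le0].
(* The extended-real infimum becomes the finite value [f xstar], so the integrand is [gap (x t)]. *)
rewrite -xstar_min.
have -> : enorm (x 0 - xstar) ^+ 2 / 2 = - F 0.
  rewrite opprK /enorm sqr_sqrtr ?sumr_ge0// => [|i _]; last exact: sqr_ge0.
  by congr (_ / _); apply: eq_bigr => i _; rewrite !mxE.
apply: (@le_trans _ _ (\int[lebesgue_measure]_(t in `[0%R, +oo[) (h (x t))%:E)%E).
  apply: ge0_le_integral => //.
  - move=> t _; rewrite -EFinB lee_fin; exact: gap_ge0.
  - apply/measurable_EFinP.
    by apply: subspace_continuous_measurable_fun => //; exact: (c_comp gap).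
  - apply/measurable_EFinP.
    by apply: subspace_continuous_measurable_fun => //; exact: (c_comp h).
  - by move=> t _; rewrite -EFinB lee_fin; exact: gap_le.
(* The integral equals [l - F 0], which is at most [- F 0] since l <= 0. *)
rewrite (@ge0_continuous_FTC2y _ (h \o x) F 0 l) //.
- by rewrite -EFinB lee_fin gerDr.
- by move=> t _; rewrite (le_trans _ (gap_le _)).
- exact: c_comp.
- by move=> t /dF ?; exact: ex_derive.
(* Endpoint condition: [F] is right-continuous at 0. *)
- by have /continuous_within_itvcyP[] := cF.
- move=> t; rewrite in_itv/= andbT => /dF ?.
  by rewrite derive1E derive_val.
Unshelve. all: by end_near. Qed.
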